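(* Let $n,p$ be positive integers and let $\Phi_1,\Phi_2\in\mathbb{R}^{p\times p}$ be two distinct orthogonal transforms (orthogonal matrices) such that $U:=\Phi_2\Phi_1^{\top}$ is not a signed permutation matrix. Then the following statements hold. 1. There exist tensors $\mathcal{A},\mathcal{B}\in\mathbb{C}^{n\times n\times p}$ that are both $\Phi_1$-Hermitian and $\Phi_2$-Hermitian such that $$\Delta_{\Phi_1}(\mathcal{A},\mathcal{B})=0,\qquad \Delta_{\Phi_2}(\mathcal{A},\mathcal{B})>0.$$ 2. There exist tensors $\mathcal{A}',\mathcal{B}'\in\mathbb{C}^{n\times n\times p}$ that are both $\Phi_1$-Hermitian and $\Phi_2$-Hermitian such that $$\Delta_{\Phi_1}(\mathcal{A}',\mathcal{B}')>0,\qquad \Delta_{\Phi_2}(\mathcal{A}',\mathcal{B}')=0.$$ In particular, no single orthogonal transform is universally optimal (i.e. minimizes the defect $\Delta_\Phi$ for all tensor pairs simultaneously); the optimal transform depends on the joint structure of the tensor pair.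
   Context: For a tensor $\mathcal{X}\in\mathbb{C}^{n\times n\times p}$ with frontal slices $\mathcal{X}^{(k)}\in\mathbb{C}^{n\times n}$ and a unitary $\Phi\in\mathbb{C}^{p\times p}$, the transformed slices are $\hat{\mathcal{X}}_{\Phi}^{(\omega)}=\sum_{k=1}^p\Phi_{\omega k}\mathcal{X}^{(k)}$, $\omega=1,\dots,p$, and the lifting is $\overline{\mathcal{X}}_{\Phi}=\operatorname{blockdiag}(\hat{\mathcal{X}}_{\Phi}^{(1)},\dots,\hat{\mathcal{X}}_{\Phi}^{(p)})$. A tensor is determined by its lifting. $\mathcal{A}\star_\Phi\mathcal{B}$, $\mathcal{A}\oplus_\Phi\mathcal{B}$, $\exp_\Phi(\mathcal{A})$ are the tensors whose liftings are $\overline{\mathcal{A}}_{\Phi}\overline{\mathcal{B}}_{\Phi}$, $\overline{\mathcal{A}}_{\Phi}+\overline{\mathcal{B}}_{\Phi}$, and the matrix exponential $\exp(\overline{\mathcal{A}}_{\Phi})$; $\operatorname{Tr}_\Phi(\mathcal{A})=\operatorname{Tr}(\overline{\mathcal{A}}_{\Phi})$. $\mathcal{A}$ is $\Phi$-Hermitian if $\overline{\mathcal{A}}_{\Phi}$ is Hermitian. The Golden--Thompson defect is $$\Delta_{\Phi}(\mathcal{A},\mathcal{B})=\operatorname{Tr}_{\Phi}\bigl(\exp_{\Phi}(\mathcal{A})\star_{\Phi}\exp_{\Phi}(\mathcal{B})\bigr)-\operatorname{Tr}_{\Phi}\bigl(\exp_{\Phi}(\mathcal{A}\oplus_{\Phi}\mathcal{B})\bigr).$$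 A signed permutation matrix is a square matrix with exactly one nonzero entry in each row and column, that entry being $\pm1$.
   Formalization: The formal theorem assumes n ≥ 2 instead of n ≥ 1: for n = 1 all transformed slices are scalars, so every defect is 0 and the claim Δ > 0 fails (e.g. p = 2, Φ1 = I, Φ2 a rotation by 45 degrees). *)

(* Defs.v *)
From HB Require Import structures.
From mathcomp Require Import all_boot all_order all_algebra.
From mathcomp Require Import complex.
From mathcomp Require Import all_classical all_reals all_analysis.

Set Implicit Arguments.
Unset Strict Implicit.
Unset Printing Implicit Defensive.

Import Order.TTheory GRing.Theory Num.Theory numFieldNormedType.Exports.

Local Open Scope classical_set_scope.
Local Open Scope complex_scope.
Local Open Scope sesquilinear_scope.
Local Open Scope ring_scope.

Definition expmx (R : realType) (m : nat) (A : 'M[R[i]]_m) : 'M[R[i]]_m :=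
  lim (series (fun k => (k`!%:R)^-1 *: A ^+ k) @ \oo).

(* The k-th component of a tensor is its k-th frontal slice. *)
Definition tensor (R : realType) (n p : nat) := {ffun 'I_p -> 'M[R[i]]_n}.

Definition hatslice (R : realType) (n p : nat) (Phi : 'M[R[i]]_p)
    (X : tensor R n p) (w : 'I_p) : 'M[R[i]]_n :=
  \sum_(k < p) Phi w k *: X k.

Definition lifting (R : realType) (n p : nat) (Phi : 'M[R[i]]_p)
    (X : tensor R n p) : 'M[R[i]]_(\sum_(w < p) n) :=
  \mxdiag_(w < p) hatslice Phi X w.

(* Inverse of [lifting] for unitary Phi, by X_k = sum_w conj(Phi_wk) hat(X)_w;
   only meaningful on block diagonal matrices. *)
Definition unlifting (R : realType) (n p : nat) (Phi : 'M[R[i]]_p)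
    (M : 'M[R[i]]_(\sum_(w < p) n)) : tensor R n p :=
  [ffun k => \sum_(w < p) (Phi w k)^* *: submxblock M w w].

Definition tmul (R : realType) (n p : nat) (Phi : 'M[R[i]]_p)
    (A B : tensor R n p) : tensor R n p :=
  unlifting Phi (lifting Phi A *m lifting Phi B).

Definition tadd (R : realType) (n p : nat) (Phi : 'M[R[i]]_p)
    (A B : tensor R n p) : tensor R n p :=
  unlifting Phi (lifting Phi A + lifting Phi B).

Definition texp (R : realType) (n p : nat) (Phi : 'M[R[i]]_p)
    (A : tensor R n p) : tensor R n p :=
  unlifting Phi (expmx (lifting Phi A)).

Definition ttrace (R : realType) (n p : nat) (Phi : 'M[R[i]]_p)
    (A : tensor R n p) : R[i] :=
  \tr (lifting Phi A).

Definition thermitian (R : realType) (n p : nat) (Phi : 'M[R[i]]_p)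
    (A : tensor R n p) : bool :=
  lifting Phi A \is hermsymmx.

Definition GTdefect (R : realType) (n p : nat) (Phi : 'M[R[i]]_p)
    (A B : tensor R n p) : R[i] :=
  ttrace Phi (tmul Phi (texp Phi A) (texp Phi B))
  - ttrace Phi (texp Phi (tadd Phi A B)).

Definition orthogonalmx (R : realType) (p : nat) (Phi : 'M[R]_p) : Prop :=
  Phi *m Phi^T = 1%:M.

Definition signed_perm_mx (R : realType) (p : nat) (U : 'M[R]_p) : Prop :=
  [/\ forall i, exists! j, U i j <> 0,
      forall j, exists! i, U i j <> 0 &
      forall i j, U i j <> 0 -> U i j = 1 \/ U i j = -1].

Definition cplxmx (R : realType) (p : nat) (Phi : 'M[R]_p) : 'M[R[i]]_p :=
  map_mx (real_complex R) Phi.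

(* [<=] on R[i] forces equal imaginary parts; defects of Hermitian pairs are
   real. *)
Definition optimal_for (R : realType) (n p : nat) (Phi : 'M[R]_p)
    (A B : tensor R n p) : Prop :=
  forall Psi : 'M[R]_p, orthogonalmx Psi ->
    GTdefect (cplxmx Phi) A B <= GTdefect (cplxmx Psi) A B.

(* For orthogonal (real) Phi, a Phi-Hermitian tensor is Psi-Hermitian for
   every orthogonal Psi. *)
Definition universally_optimal (R : realType) (n p : nat) (Phi : 'M[R]_p)
    : Prop :=
  forall A B : tensor R n p,
    thermitian (cplxmx Phi) A -> thermitian (cplxmx Phi) B ->
    optimal_for Phi A B.

Lemma unitary_cplxmx (R : realType) (p : nat) (Phi : 'M[R]_p) :
  orthogonalmx Phi -> cplxmx Phi \is unitarymx.
Proof.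
move=> PhiO; apply/unitarymxP.
rewrite /cplxmx map_trmx -map_mx_comp.
rewrite (_ : map_mx _ (Phi^T) = map_mx (real_complex R) Phi^T).
  by rewrite -map_mxM PhiO map_mx1.
by apply/matrixP => i j; rewrite !mxE; apply: conjc_real.
Qed.

Lemma unliftK (R : realType) (n p : nat) (Phi : 'M[R[i]]_p)
    (D : 'I_p -> 'M[R[i]]_n) :
  Phi \is unitarymx -> lifting Phi (unlifting Phi (\mxdiag_w D w)) = \mxdiag_w D w.
Proof.
move=> /unitarymxP PhiU; apply: eq_mxdiag => w; rewrite /hatslice.
under eq_bigr do rewrite ffunE scaler_sumr.
rewrite exchange_big /= (bigD1 w) //= [X in _ + X]big1 ?addr0.
  under eq_bigr do rewrite submxblock_diag scalerA.
  rewrite -scaler_suml.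
  suff -> : \sum_i Phi w i * (Phi w i)^* = 1 by rewrite scale1r.
  have := congr1 (fun M : 'M[R[i]]_p => M w w) PhiU.
  rewrite /= !mxE eqxx mulr1n => {}PhiU.
  rewrite -[RHS]PhiU.
  by apply: eq_bigr => k _; rewrite !mxE.
move=> v vw; under eq_bigr do rewrite submxblock_diag scalerA.
rewrite -scaler_suml.
suff -> : \sum_i Phi w i * (Phi v i)^* = 0 by rewrite scale0r.
have := congr1 (fun M : 'M[R[i]]_p => M w v) PhiU.
rewrite /= !mxE eq_sym (negPf vw) mulr0n => {}PhiU; rewrite -[RHS]PhiU.
by apply: eq_bigr => k _; rewrite !mxE.
Qed.

Lemma liftK (R : realType) (n p : nat) (Phi : 'M[R[i]]_p) :
  Phi \is unitarymx -> cancel (@lifting R n p Phi) (unlifting Phi).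
Proof.
move=> PhiU X; apply/ffunP => k; rewrite ffunE.
under eq_bigr do rewrite submxblock_diag scaler_sumr.
rewrite exchange_big /=.
have {}PhiU : Phi ^t* *m Phi = 1%:M by apply/mulmx1C/unitarymxP.
rewrite (bigD1 k) //= [X in _ + X]big1 ?addr0.
  under eq_bigr do rewrite scalerA.
  rewrite -scaler_suml.
  suff -> : \sum_i (Phi i k)^* * Phi i k = 1 by rewrite scale1r.
  have := congr1 (fun M : 'M[R[i]]_p => M k k) PhiU.
  rewrite /= !mxE eqxx mulr1n => {}PhiU.
  rewrite -[RHS]PhiU.
  by apply: eq_bigr => l _; rewrite !mxE.
move=> l lk; under eq_bigr do rewrite scalerA.
rewrite -scaler_suml.
suff -> : \sum_i (Phi i k)^* * Phi i l = 0 by rewrite scale0r.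
have := congr1 (fun M : 'M[R[i]]_p => M k l) PhiU.
rewrite /= !mxE eq_sym (negPf lk) mulr0n => {}PhiU; rewrite -[RHS]PhiU.
by apply: eq_bigr => m _; rewrite !mxE.
Qed.

Lemma mul_mxdiag2 (R : realType) (n p : nat) (D E : 'I_p -> 'M[R[i]]_n) :
  (\mxdiag_w D w) *m (\mxdiag_w E w) = \mxdiag_w (D w *m E w).
Proof.
rewrite {1}/mxdiag mul_mxblock_mxdiag; apply: eq_mxblock => i j.
by case: eqP => [<-|_]; rewrite ?conform_mx_id ?mul0mx.
Qed.

Lemma exp_mxdiag (R : realType) (n p : nat) (D : 'I_p -> 'M[R[i]]_n) k :
  (\mxdiag_w D w) ^+ k = \mxdiag_w (D w ^+ k).
Proof.
elim: k => [|k IH].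
  rewrite expr0 (_ : 1 = 1%:M) // -mxdiagZ.
  by apply: eq_mxdiag => w; rewrite expr0.
rewrite exprS IH (_ : _ * _ = (\mxdiag_w D w) *m (\mxdiag_w (D w ^+ k))) //.
by rewrite mul_mxdiag2; apply: eq_mxdiag => w; rewrite exprS.
Qed.

Lemma lift_tmul (R : realType) (n p : nat) (Phi : 'M[R[i]]_p)
    (A B : tensor R n p) :
  Phi \is unitarymx -> lifting Phi (tmul Phi A B) = lifting Phi A *m lifting Phi B.
Proof. by move=> PhiU; rewrite /tmul mul_mxdiag2 unliftK. Qed.

Lemma lift_tadd (R : realType) (n p : nat) (Phi : 'M[R[i]]_p)
    (A B : tensor R n p) :
  Phi \is unitarymx -> lifting Phi (tadd Phi A B) = lifting Phi A + lifting Phi B.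
Proof. by move=> PhiU; rewrite /tadd -mxdiagD unliftK. Qed.

Lemma cvg_mx_entry (K : numFieldType) (m n : nat) (u : nat -> 'M[K]_(m, n))
    (L : 'M[K]_(m, n)) :
  (forall i j, (fun k => u k i j) @ \oo --> L i j) -> u @ \oo --> L.
Proof.
move=> uL; apply/cvg_mx_entourageP => E entE; near=> k => i j; rewrite inE.
move: (i) (j); near: k.
apply: filter_forall => i; apply: filter_forall => j.
by have /cvg_app_entourageP := uL i j; exact.
Unshelve. all: by end_near. Qed.

Lemma is_cvg_linear (K : numFieldType) (u v w : nat -> K) (z : K) :
  (forall k, w k = u k + z * v k) -> cvgn u -> cvgn v -> cvgn w.
Proof. move=> /funext ->; by move=> cu cv; apply: is_cvgD => //; apply: is_cvgMr. Qed.

Lemma cvg_complex (R : realType) (a b : nat -> R) :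
  cvgn a -> cvgn b -> cvgn ((fun k => a k +i* b k) : nat -> (R[i] : numFieldType)).
Proof.
have cvgC (c : nat -> R) : cvgn c ->
    cvgn ((fun k => (c k)%:C) : nat -> (R[i] : numFieldType)).
  move=> /cvg_ex[l cl]; apply/cvg_ex; exists (l%:C).
  apply/cvgrPdist_lt => e e0.
  have eE : e = (complex.Re e)%:C.
    by move: e0; case: e => x y; rewrite ltcE /= => /andP[/eqP ->].
  have {}e0 : 0 < complex.Re e by move: e0; rewrite ltcE /= => /andP[].
  move/cvgrPdist_lt : cl => /(_ _ e0); apply: filterS => k.
  by rewrite -rmorphB normc_def /= expr0n addr0 sqrtr_sqr eE ltcR.
move=> /cvgC Ca /cvgC Cb.
by apply: is_cvg_linear Ca Cb => k; exact: complexE.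
Qed.

Lemma cvg_expmx (R : realType) (m : nat) (A : 'M[R[i]]_m) :
  cvgn (series (fun k => (k`!%:R)^-1 *: A ^+ k)).
Proof.
pose K : R[i] := \sum_i \sum_j `|A i j|.
have K0 : 0 <= K by apply: sumr_ge0 => i _; apply: sumr_ge0.
have AK k i j : `|(A ^+ k) i j| <= K ^+ k.
  elim: k i j => [|k IH] i j.
    by rewrite !expr0 mxE normr_nat; case: eqP.
  rewrite !exprS mxE; apply: (le_trans (ler_norm_sum _ _ _)).
  apply: (@le_trans _ _ ((\sum_j `|A i j|) * K ^+ k)); last first.
    rewrite ler_wpM2r ?exprn_ge0 // /K [leRHS](bigD1 i) //= lerDl.
    by apply: sumr_ge0 => *; apply: sumr_ge0.
  rewrite mulr_suml; apply: ler_sum => l _.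
  by rewrite normrM ler_wpM2l.
have [x x0 Kx] : exists2 x : R, 0 <= x & K = x%:C.
  exists (complex.Re K); first by move: K0; rewrite lecE => /andP[].
  by move: K0; case: K {AK} => x y; rewrite lecE /= => /andP[/eqP ->].
pose c i j k : (R[i] : numFieldType) := (k`!%:R)^-1 * (A ^+ k) i j.
have cle i j k : complex.Re `|c i j k| <= exp_coeff x k.
  suff : `|c i j k| <= (exp_coeff x k)%:C by rewrite lecE => /andP[].
  rewrite normrM normfV normr_nat /exp_coeff /= rmorphM rmorphXn fmorphV.
  rewrite rmorph_nat mulrC ler_wpM2r //.
  by have := AK k i j; rewrite Kx.
have abs (f : nat -> R) (i j : 'I_m) : (forall k, `|f k| <= complex.Re `|c i j k|) ->
    cvgn (series f).
  move=> fc; apply: normed_cvg.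
  apply: (series_le_cvg _ _ _ (is_cvg_series_exp_coeff x)) => k //.
  - exact: normr_ge0.
  - exact: exp_coeff_ge0.
  - exact: (le_trans (fc k) (cle i j k)).
have cc i j : cvgn (series (c i j)).
  rewrite (_ : series _ = fun k => series (fun l => complex.Re (c i j l)) k +i*
      series (fun l => complex.Im (c i j l)) k).
    apply: cvg_complex; apply: (abs _ i j) => k.
      by rewrite normc_def /= -sqrtr_sqr ler_wsqrtr // lerDl sqr_ge0.
    by rewrite normc_def /= -sqrtr_sqr ler_wsqrtr // lerDr sqr_ge0.
  apply/funext => k; rewrite /series /=.
  elim: k => [|k IH]; first by rewrite !big_geq.
  by rewrite !big_nat_recr //= IH; case: (c i j k).
apply/cvg_ex; exists (\matrix_(i, j) lim (series (c i j) @ \oo)).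
apply: cvg_mx_entry => i j; rewrite mxE.
rewrite (_ : (fun k => _) = series (c i j)); first exact: cc.
apply/funext => k; rewrite /series /= summxE.
by apply: eq_bigr => l _; rewrite mxE.
Qed.

Lemma expmx_mxdiag (R : realType) (n p : nat) (D : 'I_p -> 'M[R[i]]_n) :
  expmx (\mxdiag_w D w) = \mxdiag_w expmx (D w).
Proof.
have scale_mxdiag (a : R[i]) (E : 'I_p -> 'M[R[i]]_n) :
    a *: (\mxdiag_w E w) = \mxdiag_w (a *: E w).
  rewrite /mxdiag; apply/matrixP => s t; rewrite !mxE.
  by case: eqP => [_|_]; rewrite ?conform_mx_id !mxE ?mulr0.
have part k : series (fun k => (k`!%:R)^-1 *: (\mxdiag_w D w) ^+ k) k =
    \mxdiag_w series (fun k => (k`!%:R)^-1 *: D w ^+ k) k.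
  elim: k => [|k IH].
    rewrite /series /= [LHS]big_geq // -[LHS]mxdiag0.
    by apply: eq_mxdiag => w; rewrite big_geq.
  rewrite seriesSr IH exp_mxdiag scale_mxdiag -mxdiagD.
  by apply: eq_mxdiag => w; rewrite seriesSr.
rewrite {1}/expmx; apply: (cvg_lim (@norm_hausdorff _ _)).
apply: cvg_mx_entry => s t.
rewrite (_ : (fun k => _) = fun k =>
    (\mxdiag_w series (fun k => (k`!%:R)^-1 *: D w ^+ k) k) s t); last first.
  by apply/funext => k; rewrite part.
rewrite /mxdiag [X in _ --> X]mxE.
under eq_fun do rewrite mxE.
case: eqP => [e|_]; last exact: cvg_cst.
have H := @cvg_expmx R n (D (tagnat.sig1 s)).
have := cvg_comp _ _ H (@coord_continuous _ _ _ (tagnat.sig2 s : 'I_n)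
  (tagnat.sig2 t : 'I_n) _).
rewrite conform_mx_id; apply: cvg_trans.
rewrite (_ : (fun k => conform_mx _ _ _ _) = (fun k => series
  (fun k => (k`!%:R)^-1 *: D (tagnat.sig1 s) ^+ k) k
  (tagnat.sig2 s : 'I_n) (tagnat.sig2 t : 'I_n))).
  exact: cvg_id.
by apply/funext => k; rewrite conform_mx_id.
Qed.

Lemma lift_texp (R : realType) (n p : nat) (Phi : 'M[R[i]]_p)
    (A : tensor R n p) :
  Phi \is unitarymx -> lifting Phi (texp Phi A) = expmx (lifting Phi A).
Proof. by move=> PhiU; rewrite /texp expmx_mxdiag unliftK. Qed.

Lemma thermitianP (R : realType) (n p : nat) (Phi : 'M[R[i]]_p)
    (X : tensor R n p) :
  thermitian Phi X <-> forall w, hatslice Phi X w \is hermsymmx.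
Proof.
have trC : (lifting Phi X) ^t* = \mxdiag_w (hatslice Phi X w) ^t*.
  rewrite /lifting tr_mxdiag /mxdiag; apply/matrixP => s t; rewrite !mxE.
  by case: eqP => [_|_]; rewrite ?conform_mx_id !mxE ?conjC0.
split=> [/is_hermitianmxP XH w|XH]; last first.
  apply/is_hermitianmxP; rewrite expr0 scale1r trC; apply: eq_mxdiag => w.
  by have /is_hermitianmxP := XH w; rewrite expr0 scale1r.
apply/is_hermitianmxP; rewrite expr0 scale1r.
by move: XH w; rewrite expr0 scale1r trC => /eq_mxdiagP.
Qed.

Lemma thermitian_orthogonal (R : realType) (n p : nat) (Phi Psi : 'M[R]_p)
    (X : tensor R n p) :
  orthogonalmx Phi -> thermitian (cplxmx Phi) X -> thermitian (cplxmx Psi) X.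
Proof.
have herm_sum (I : finType) (c : I -> R) (F : I -> 'M[R[i]]_n) :
    (forall k, F k \is hermsymmx) -> \sum_k (c k)%:C *: F k \is hermsymmx.
  move=> FH; apply/is_hermitianmxP; rewrite expr0 scale1r.
  apply/matrixP => i j; rewrite !mxE !summxE rmorph_sum; apply: eq_bigr => k _.
  rewrite !mxE rmorphM /=; congr (_ * _); first by rewrite [RHS]conjc_real.
  have /is_hermitianmxP := FH k; rewrite expr0 scale1r => {1}->.
  by rewrite !mxE.
move=> /unitary_cplxmx PhiU /thermitianP XH; apply/thermitianP => w.
have XkH k : X k \is hermsymmx.
  rewrite -(liftK PhiU X) ffunE.
  under eq_bigr do rewrite submxblock_diag mxE [(_)^*]conjc_real.
  exact: herm_sum.
rewrite /hatslice; under eq_bigr do rewrite mxE; exact: herm_sum.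
Qed.

(* Main.v *)
Require Import Defs.
From HB Require Import structures.
From mathcomp Require Import all_boot all_order all_algebra.
From mathcomp Require Import complex.
From mathcomp Require Import all_classical all_reals all_analysis.
From mathcomp Require Import ring lra.
Import Order.TTheory GRing.Theory Num.Theory numFieldNormedType.Exports.
Local Open Scope ring_scope.

(** The lifting is block diagonal, so a defect is the sum over
    the transformed slices of the gaps
    tr (exp X exp Y) - tr (exp (X + Y)).  Such a gap vanishes when one of the
    two slices is zero, and it is positive when the slices are nonzero
    multiples of two anticommuting Hermitian matrices.

    Let H and K be the Pauli matrices sigma_z and sigma_x, padded with zeros
    to size n.  Let A be the tensor whose Phi1-transform is H in slice j and
    zero elsewhere, and B the one whose Phi1-transform is K in slice k.  Under
    another orthogonal transform Psi, with V = Psi Phi1^T, the slices become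
    V_wj H and V_wk K ([hatslice_one_slice]).  As H and K anticommute and
    have the same square P, every s H + t K is a multiple of a matrix J with
    J^3 = J; hence its exponential is explicit ([expmx_tripotent]) and
    ([GTgap_anticomm]) the gap of s H and t K is
    tr P (cosh s cosh t - cosh (sqrt (s^2 + t^2))).
    Comparing power series, this is at least tr P (s t)^2 / 6 ([coshM_ge]):
    for these pairs the Golden-Thompson inequality and its strictness come
    from an elementary estimate.

    So the defect of (A, B) is nonnegative for every Psi, is zero for Phi1 if
    j <> k (then V = 1 has no row meeting both columns), and is positive for
    Phi2 as soon as some row of U = Phi2 Phi1^T is nonzero in both columns j
    and k.  Such a row exists precisely because an orthogonal matrix having at
    most one nonzero entry in each row is a signed permutation matrix
    ([orthogonal_not_signed_perm]).  This pair ([separating_pair]) gives the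
    first claim and, with the two transforms exchanged, the second; nonnegativity
    for all Psi makes Phi1 optimal for it and Phi2 not.  Finally, signed
    permutation matrices are stable under (U, V) |-> V U^T, so any orthogonal
    Phi differs from Phi1 or from Phi2 by a matrix that is not one of them, and
    a separating pair defeats Phi. *)

Set Implicit Arguments.
Unset Strict Implicit.
Unset Printing Implicit Defensive.

(** * Hyperbolic cosines *)

Definition cosh (R : realType) (x : R) : R := (expR x + expR (- x)) / 2.

Definition sinh (R : realType) (x : R) : R := (expR x - expR (- x)) / 2.

Lemma cosh0 (R : realType) : cosh (0 : R) = 1.
Proof. by rewrite /cosh oppr0 expR0; field. Qed.

Lemma coshM (R : realType) (s t : R) :
  2 * (cosh s * cosh t) = cosh (s + t) + cosh (s - t).
Proof. by rewrite /cosh !(opprD, opprK, expRD); field. Qed.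

(** Convexity of the m-th power at a midpoint.  The induction step works
    because x - y and x^m - y^m have the same sign. *)
Lemma power_mean (R : realType) (x y : R) (m : nat) : 0 <= x -> 0 <= y ->
  2 * ((x + y) / 2) ^+ m <= x ^+ m + y ^+ m.
Proof.
move=> x0 y0; elim: m => [|m IH]; first by rewrite !expr0; lra.
have mix : 0 <= (x - y) * (x ^+ m - y ^+ m).
  have [xy|/ltW yx] := leP x y.
    by rewrite mulr_le0 ?subr_le0 // lerXn2r.
  by rewrite mulr_ge0 ?subr_ge0 // lerXn2r.
have h0 : 0 <= (x + y) / 2 by lra.
have := ler_wpM2l h0 IH; rewrite !exprS; nra.
Qed.

(** The odd coefficients cancel, and in even degree k = 2 m the claim is the
    midpoint convexity of the m-th power at (s + t)^2 and (s - t)^2, whose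
    mean is r^2. *)
Lemma cosh_coef_gap_ge0 (R : realType) (s t r : R) (k : nat) : r ^+ 2 = s ^+ 2 + t ^+ 2 ->
  0 <= ((s + t) ^+ k + (- (s + t)) ^+ k) + ((s - t) ^+ k + (- (s - t)) ^+ k)
       - 2 * (r ^+ k + (- r) ^+ k).
Proof.
move=> rst; rewrite (exprNn (s + t)) (exprNn (s - t)) (exprNn r) -signr_odd.
have [_|ke] := boolP (odd k); first by rewrite expr1 !mulN1r !subrr mulr0 subr0 addr0.
have := @power_mean R ((s + t) ^+ 2) ((s - t) ^+ 2) k./2 (sqr_ge0 _) (sqr_ge0 _).
have -> : ((s + t) ^+ 2 + (s - t) ^+ 2) / 2 = r ^+ 2 by rewrite rst; field.
rewrite -!exprM mul2n even_halfK // expr0 !mul1r.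
by move: (_ ^+ k) (_ ^+ k) (_ ^+ k) => x y z; lra.
Qed.

(** With 2 cosh s cosh t = cosh (s + t) + cosh (s - t), the gap is the sum of a
    series with nonnegative terms, so it dominates the term of degree 4, the
    first one that is not identically zero. *)
Lemma coshM_ge (R : realType) (s t r : R) : r ^+ 2 = s ^+ 2 + t ^+ 2 ->
  (s * t) ^+ 2 / 6 <= cosh s * cosh t - cosh r.
Proof.
move=> rst.
pose e (x : R) k := exp_coeff x k + exp_coeff (- x) k.
(* As [e x] sums to 2 cosh x, dividing by 4 makes [d] sum to the gap. *)
pose d k := (e (s + t) k + e (s - t) k - 2 * e r k) / 4.
have eC (x : R) : (series (e x) @ \oo --> 2 * cosh x)%classic.
  have -> : series (e x) = series (exp_coeff x) \+ series (exp_coeff (- x)).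
    by apply/funext => k; rewrite /series /= -big_split.
  rewrite (_ : 2 * cosh x = expR x + expR (- x)); last by rewrite /cosh; field.
  by apply: cvgD; apply: is_cvg_series_exp_coeff.
have dC : (series d @ \oo --> cosh s * cosh t - cosh r)%classic.
  have -> : series d = (fun k => (series (e (s + t)) k + series (e (s - t)) k
              - 2 * series (e r) k) * 4^-1).
    apply/funext => k; rewrite /series /= /d !mulr_sumr -big_split -sumrB /=.
    by rewrite mulr_suml.
  have -> : cosh s * cosh t - cosh r
      = (2 * cosh (s + t) + 2 * cosh (s - t) - 2 * (2 * cosh r)) * 4^-1.
    by rewrite -[in RHS]mulrDr -coshM; field.
  apply: cvgMr_tmp.
  exact: (cvgB (cvgD (eC _) (eC _)) (cvgMl_tmp (a := 2) (eC r))).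
have d0 k : 0 <= d k.
  have -> : d k = (((s + t) ^+ k + (- (s + t)) ^+ k)
      + ((s - t) ^+ k + (- (s - t)) ^+ k) - 2 * (r ^+ k + (- r) ^+ k))
      / k`!%:R / 4.
    by rewrite /d /e /exp_coeff /=; field; rewrite pnatr_eq0 -lt0n fact_gt0.
  by rewrite !divr_ge0 ?cosh_coef_gap_ge0 ?ler0n.
have d4 : d 4 = (s * t) ^+ 2 / 6.
  rewrite /d /e /exp_coeff /= (_ : 4`! = 24)%N //.
  have -> : r ^+ 4 = (s ^+ 2 + t ^+ 2) ^+ 2 by rewrite -rst -exprM.
  have -> : (- r) ^+ 4 = (s ^+ 2 + t ^+ 2) ^+ 2 by rewrite -rst -exprM exprNn; ring.
  by field.
have dmono : nondecreasing_seq (series d) by apply: nondecreasing_series => k _ _.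
rewrite -d4 -(cvg_lim (@Rhausdorff R) dC).
apply: (@le_trans _ _ (series d 5)).
  rewrite /series /= big_nat_recr //= lerDr; exact: sumr_ge0.
by apply: nondecreasing_cvgn_le => //; apply/cvg_ex; eexists; exact: dC.
Qed.

(** * Exponential of a tripotent matrix *)

Lemma cvg_real_complex (R : realType) (u : nat -> R) (l : R) :
  (u @ \oo --> l)%classic ->
  ((fun k => (u k)%:C%C : (R[i] : numFieldType)) @ \oo
     --> (l%:C%C : (R[i] : numFieldType)))%classic.
Proof.
move=> ul; apply/cvgrPdist_lt => e e0.
have eE : e = (complex.Re e)%:C%C.
  by move: e0; case: e => x y; rewrite ltcE /= => /andP[/eqP ->].
have {}e0 : 0 < complex.Re e by move: e0; rewrite ltcE /= => /andP[].
move/cvgrPdist_lt : ul => /(_ _ e0); apply: filterS => k.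
by rewrite -rmorphB normc_def /= expr0n addr0 sqrtr_sqr eE ltcR.
Qed.

Lemma cvg_series_real_scale (R : realType) (m : nat) (u : nat -> R) (l : R)
    (M : 'M[(R[i] : numFieldType)]_m) :
  (series u @ \oo --> l)%classic ->
  (series (fun k => (u k)%:C%C *: M) @ \oo
     --> (l%:C%C *: M : 'M[(R[i] : numFieldType)]_m))%classic.
Proof.
move=> /cvg_real_complex ul; apply: cvg_mx_entry => i j; rewrite mxE.
have -> : (fun k => series (fun k => (u k)%:C%C *: M) k i j)
    = (fun k => ((series u k)%:C%C : (R[i] : numFieldType)) * M i j).
  apply/funext => k; rewrite /series /= summxE rmorph_sum mulr_suml.
  by apply: eq_bigr => l' _; rewrite mxE.
exact: (cvgMr_tmp (b := M i j) ul).
Qed.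

(** The spectrum of J lies in {0, 1, -1}, with spectral projections 1 - J^2 and
    (J^2 + J) / 2, (J^2 - J) / 2; collecting them by 1 - J^2, J^2 and J leaves
    only the even and odd parts of the powers of r.  The coefficient 0 ^+ k
    makes the formula hold at k = 0 as well. *)
Lemma tripotent_expr (R : realType) (m : nat) (J : 'M[R[i]]_m) (r : R) (k : nat) :
  J ^+ 3 = J ->
  (r%:C%C *: J) ^+ k = (0 ^+ k)%:C%C *: (1 - J ^+ 2)
    + ((r ^+ k + (- r) ^+ k) / 2)%:C%C *: J ^+ 2
    + ((r ^+ k - (- r) ^+ k) / 2)%:C%C *: J.
Proof.
move=> J3; elim: k => [|k IH].
  rewrite !expr0 subrr mul0r scale0r addr0 -[1 + 1]/(2%:R) divff ?pnatr_eq0 //.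
  by rewrite !scale1r subrK.
have JJ2 : J * J ^+ 2 = J by rewrite -exprS.
have mulJ c (X : 'M[R[i]]_m) : (r%:C%C *: J) * (c *: X) = (r%:C%C * c) *: (J * X).
  by rewrite -[LHS]/(_ *m _) -scalemxAl -scalemxAr scalerA.
rewrite exprS IH !mulrDr !mulJ mulrBr mulr1 JJ2 subrr.
rewrite -expr2 !exprS mul0r scale0r scaler0 !add0r addrC.
by congr (_ *: _ + _ *: _); rewrite -!rmorphM /=; congr (_ %:C)%C; field.
Qed.

Lemma expmx_tripotent (R : realType) (m : nat) (J : 'M[R[i]]_m) (r : R) :
  J ^+ 3 = J ->
  expmx (r%:C%C *: J) = (1 - J ^+ 2) + (cosh r)%:C%C *: J ^+ 2 + (sinh r)%:C%C *: J.
Proof.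
move=> J3; rewrite /expmx; apply: (cvg_lim (@norm_hausdorff _ _)).
have eC (x : R) : (series (exp_coeff x) @ \oo --> expR x)%classic.
  exact: is_cvg_series_exp_coeff.
have -> : series (fun k => (k`!%:R)^-1 *: (r%:C%C *: J) ^+ k) =
    series (fun k => (exp_coeff 0 k)%:C%C *: (1 - J ^+ 2))
    \+ series (fun k => ((exp_coeff r k + exp_coeff (- r) k) / 2)%:C%C *: J ^+ 2)
    \+ series (fun k => ((exp_coeff r k - exp_coeff (- r) k) / 2)%:C%C *: J).
  apply/funext => N; rewrite /series /= -!big_split; apply: eq_bigr => k _ /=.
  rewrite tripotent_expr // 2!scalerDr !scalerA.
  have -> : (k`!%:R)^-1 = ((k`!%:R)^-1 : R)%:C%C by rewrite fmorphV rmorph_nat.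
  have E (x : R) : (k`!%:R)^-1 * x ^+ k = exp_coeff x k by rewrite mulrC.
  by rewrite -!rmorphM /= !mulrA mulrDr mulrBr !E.
rewrite -[X in (_ --> X + _ + _)%classic]scale1r.
apply: cvgD; first apply: cvgD; apply: cvg_series_real_scale.
- by rewrite -[X in (_ --> X)%classic](@expR0 R).
- rewrite (_ : series _ = fun k => (series (exp_coeff r) k
      + series (exp_coeff (- r)) k) / 2).
    exact: (cvgMr_tmp (cvgD (eC r) (eC (- r)))).
  by apply/funext => k; rewrite /series /= -big_split mulr_suml.
- rewrite (_ : series _ = fun k => (series (exp_coeff r) k
      - series (exp_coeff (- r)) k) / 2).
    exact: (cvgMr_tmp (cvgB (eC r) (eC (- r)))).
  by apply/funext => k; rewrite /series /= -sumrB mulr_suml.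
Qed.

(** * The Golden-Thompson gap of an anticommuting pair *)

Lemma mxtrace_anticomm (R : realType) (m : nat) (H K : 'M[R[i]]_m) :
  H * K = - (K * H) -> \tr (H * K) = 0.
Proof.
move=> HK; have : \tr (H * K) = - \tr (H * K).
  by rewrite {1}HK raddfN /= [\tr (K * H)]mxtrace_mulC.
by move/eqP; rewrite eq_sym eqNr => /eqP.
Qed.

(** H = H K K is itself a product of two anticommuting matrices, H K and K. *)
Lemma mxtrace_anticomm_tripotent (R : realType) (m : nat) (H K : 'M[R[i]]_m) :
  H ^+ 3 = H -> K ^+ 2 = H ^+ 2 -> H * K = - (K * H) -> \tr H = 0.
Proof.
move=> H3 K2 HK; have <- : H * K * K = H by rewrite -mulrA -expr2 K2 -exprS.
apply: mxtrace_anticomm.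
by rewrite {1}HK !mulNr mulrA.
Qed.

(** At r = 0 the angle is arbitrary; any unit vector (c, d) will do. *)
Lemma polar_decomposition (R : realType) (s t r : R) : r ^+ 2 = s ^+ 2 + t ^+ 2 ->
  exists c d : R, [/\ c ^+ 2 + d ^+ 2 = 1, s = r * c & t = r * d].
Proof.
move=> rst; have [r0|r0] := eqVneq r 0; last first.
  exists (s / r), (t / r); split; [|by field..].
  by rewrite !expr_div_n -mulrDl -rst divff // expf_eq0.
exists 1, 0; rewrite expr1n expr0n addr0 r0 !mul0r.
move/eqP: rst; rewrite r0 expr0n /= eq_sym paddr_eq0 ?sqr_ge0 // !sqrf_eq0.
by case/andP => /eqP -> /eqP ->.
Qed.

(** With s = r c and t = r d on the unit circle, J = c H + d K satisfies
    J^2 = H^2 because the cross terms cancel, so all three exponentials are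
    given by [expmx_tripotent].  In the traces only the multiples of 1 and H^2
    survive, since H, K and H K have trace zero. *)
Lemma GTgap_anticomm (R : realType) (m : nat) (H K : 'M[R[i]]_m) (s t r : R) :
  H ^+ 3 = H -> K ^+ 3 = K -> K ^+ 2 = H ^+ 2 -> H * K = - (K * H) ->
  r ^+ 2 = s ^+ 2 + t ^+ 2 ->
  \tr (expmx (s%:C%C *: H) *m expmx (t%:C%C *: K))
    - \tr (expmx (s%:C%C *: H + t%:C%C *: K))
  = \tr (H ^+ 2) * (cosh s * cosh t - cosh r)%:C%C.
Proof.
move=> H3 K3 K2 HK rst.
have KH : K * H = - (H * K) by rewrite HK opprK.
have mulZ (x y : R[i]) (X Y : 'M[R[i]]_m) : (x *: X) * (y *: Y) = (x * y) *: (X * Y).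
  by rewrite -[LHS]/(_ *m _) -scalemxAl -scalemxAr scalerA.
have trH : \tr H = 0 by apply: (@mxtrace_anticomm_tripotent _ _ H K).
have trK : \tr K = 0 by apply: (@mxtrace_anticomm_tripotent _ _ K H); rewrite ?K2.
have trHK := mxtrace_anticomm HK.
have [c [d [cd -> ->]]] := polar_decomposition rst.
set J := c%:C%C *: H + d%:C%C *: K.
have J2 : J ^+ 2 = H ^+ 2.
  rewrite expr2 mulrDl !mulrDr !mulZ KH -!expr2 K2 scalerN addrA.
  rewrite [(d%:C * _)%C]mulrC addrK -scalerDl.
  by rewrite -!rmorphXn -rmorphD /= cd scale1r.
have J3 : J ^+ 3 = J.
  rewrite exprSr J2 mulrDr.
  rewrite -[H ^+ 2]scale1r !mulZ !mul1r -{2}K2 -!exprSr.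
  by rewrite H3 K3.
have -> : (r * c)%:C%C *: H + (r * d)%:C%C *: K = r%:C%C *: J.
  by rewrite scalerDr !scalerA -!rmorphM.
rewrite !expmx_tripotent // J2 K2.
set P := H ^+ 2; move: (cosh (r * c)) (sinh (r * c)) (cosh (r * d)) (sinh (r * d)).
move=> a b a' b'.
have PH : P * H = H by rewrite -exprSr.
have HP : H * P = H by rewrite -exprS.
have PK : P * K = K by rewrite /P -K2 -exprSr.
have PP : P * P = P by rewrite -[RHS]/(H ^+ 2) expr2 -{1}PH -mulrA.
rewrite -!addrA !(addrA 1) -[_ *m _]/(_ * _).
have QQ : (1 - P) * (1 - P) = 1 - P.
  by rewrite mulrBr mulr1 mulrBl mul1r PP subrr subr0.
have QX x (X : 'M[R[i]]_m) : P * X = X -> (1 - P) * (x *: X) = 0.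
  by move=> PX; rewrite -[1 - P]scale1r mulZ mulrBl !mul1r PX subrr scaler0.
have XQ x (X : 'M[R[i]]_m) : X * P = X -> (x *: X) * (1 - P) = 0.
  by move=> PX; rewrite -[1 - P]scale1r mulZ mulrBr !mulr1 PX subrr scaler0.
(* Abstracting 1 - P keeps distributivity from splitting it. *)
move: (1 - P) QQ QX XQ => Q QQ QX XQ.
have -> : (Q + (a%:C%C *: P + b%:C%C *: H)) * (Q + (a'%:C%C *: P + b'%:C%C *: K))
   = Q + (a * a')%:C%C *: P + ((b * a')%:C%C *: H + (a * b')%:C%C *: K
      + (b * b')%:C%C *: (H * K)).
  rewrite mulrDl !mulrDr QQ !QX // !mulrDl !XQ // !mulZ PP PK HP.
  by rewrite !rmorphM /= !addr0 !add0r !addrA.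
rewrite !raddfD /= !mxtraceZ trHK trH trK.
rewrite !(mulr0, addr0) rmorphN !rmorphM /=; ring.
Qed.

(** The Pauli matrices sigma_z and sigma_x in the first two coordinates; their
    common square is the projection onto these coordinates. *)
Lemma pauli_pair (R : realType) (n : nat) : (1 < n)%N ->
  exists H K : 'M[R[i]]_n,
    [/\ H \is hermsymmx, K \is hermsymmx,
        [/\ H ^+ 3 = H, K ^+ 3 = K, K ^+ 2 = H ^+ 2 & H * K = - (K * H)] &
        \tr (H ^+ 2) = 2].
Proof.
case: n => [//|[//|n _]].
pose e (i j : 'I_n.+2) : 'M[R[i]]_n.+2 := delta_mx i j.
pose o : 'I_n.+2 := ord0; pose l : 'I_n.+2 := lift ord0 ord0.
have eM i j k h : e i j * e k h = e i h *+ (j == k) by exact: mul_delta_mx_cond.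
pose H := e o o - e l l; pose K := e o l + e l o.
have H2 : H ^+ 2 = e o o + e l l.
  by rewrite expr2 mulrBl !mulrBr !eM /= !mulr0n !mulr1n !subr0 sub0r opprK.
have K2 : K ^+ 2 = e o o + e l l.
  by rewrite expr2 mulrDl !mulrDr !eM /= !mulr0n !mulr1n addr0 add0r addrC.
have eadj i j : map_mx Num.conj (e i j)^T = e j i.
  by rewrite trmx_delta; apply/matrixP => a b; rewrite !mxE rmorph_nat.
have etr i : \tr (e i i) = 1.
  rewrite /mxtrace (bigD1 i) //= big1 ?addr0 => [|j /negPf ji].
    by rewrite mxE !eqxx.
  by rewrite mxE ji.
exists H, K; split.
- apply/is_hermitianmxP; rewrite expr0 scale1r.
  by rewrite raddfB /= map_mxB !eadj.
- apply/is_hermitianmxP; rewrite expr0 scale1r.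
  by rewrite raddfD /= map_mxD !eadj addrC.
- split.
  + rewrite exprSr H2 mulrDl !mulrBr !eM /= !mulr0n !mulr1n.
    by rewrite subr0 sub0r.
  + rewrite exprSr K2 mulrDl !mulrDr !eM /= !mulr0n !mulr1n.
    by rewrite addr0 add0r.
  + by rewrite K2 H2.
  + rewrite mulrBl mulrDl !mulrBr !mulrDr !eM /= !mulr0n !mulr1n.
    by rewrite !(addr0, add0r, subr0, sub0r) opprD opprK addrC.
- by rewrite H2 raddfD /= !etr.
Qed.

(** * Signed permutation matrices *)

Lemma orthogonalmx_row (R : realType) (p : nat) (U : 'M[R]_p) (i i' : 'I_p) :
  orthogonalmx U -> \sum_j U i j * U i' j = (i == i')%:R.
Proof.
move=> /matrixP /(_ i i'); rewrite !mxE => <-.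
by apply: eq_bigr => j _; rewrite mxE.
Qed.

Lemma orthogonalmx_tr (R : realType) (p : nat) (U : 'M[R]_p) :
  orthogonalmx U -> orthogonalmx U^T.
Proof. by rewrite /orthogonalmx trmxK => /mulmx1C. Qed.

Lemma orthogonalmxM (R : realType) (p : nat) (U V : 'M[R]_p) :
  orthogonalmx U -> orthogonalmx V -> orthogonalmx (U *m V).
Proof.
rewrite /orthogonalmx => UO VO.
by rewrite trmx_mul mulmxA -(mulmxA U) VO mulmx1.
Qed.

Lemma signed_perm_mx_tr (R : realType) (p : nat) (U : 'M[R]_p) :
  signed_perm_mx U -> signed_perm_mx U^T.
Proof.
case=> rU cU vU; split=> [i|j|i j]; last by rewrite mxE; exact: vU.
- by have [j [jU ju]] := cU i; exists j; split=> [|k]; rewrite mxE //; exact: ju.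
- by have [i [iU iu]] := rU j; exists i; split=> [|k]; rewrite mxE //; exact: iu.
Qed.

(** Rows and columns of an orthogonal matrix are unit vectors.  If no row has
    two nonzero entries, then each row has exactly one, equal to 1 or -1, and
    two rows sharing their nonzero column would not be orthogonal. *)
Lemma orthogonal_not_signed_perm (R : realType) (p : nat) (U : 'M[R]_p) :
  orthogonalmx U -> ~ signed_perm_mx U ->
  exists i j k, [/\ j != k, U i j != 0 & U i k != 0].
Proof.
move=> UO; apply: contra_notP => /forallNP nU.
have uniq_nz i j k : U i j != 0 -> U i k != 0 -> j = k.
  move=> Uj Uk; apply/eqP/negPn/negP => jk.
  by apply: (nU i); exists j, k.
have row_sum i j : U i j != 0 -> forall x : 'I_p -> R, \sum_k U i k * x k = U i j * x j.
  move=> Uij x; rewrite (bigD1 j) //= big1 ?addr0 // => k kj.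
  have [->|Uik] := eqVneq (U i k) 0; first by rewrite mul0r.
  by rewrite (uniq_nz _ _ _ Uik Uij) eqxx in kj.
have nz_row (V : 'M[R]_p) i : orthogonalmx V -> exists j, V i j != 0.
  move=> VO; have [//|/forallNP V0] := pselect (exists j, V i j != 0).
  have := orthogonalmx_row i i VO; rewrite eqxx big1 => [|j _].
    by move/eqP; rewrite eq_sym oner_eq0.
  by have /negP := V0 j; rewrite negbK => /eqP ->; rewrite mul0r.
split=> [i|j|i j /eqP Uij].
- have [j Uij] := nz_row U i UO; exists j; split=> [|k /eqP]; first exact/eqP.
  exact: uniq_nz.
- have [a] := nz_row _ j (orthogonalmx_tr UO); rewrite mxE => Uaj.
  exists a; split=> [|b /eqP Ubj]; first exact/eqP.
  apply/eqP/negPn/negP => ab.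
  have := orthogonalmx_row a b UO; rewrite (row_sum _ _ Uaj) (negPf ab).
  by move/eqP; rewrite mulf_eq0 (negPf Uaj) (negPf Ubj).
- have := orthogonalmx_row i i UO; rewrite (row_sum _ _ Uij) eqxx -expr2.
  by move/eqP; rewrite sqrf_eq1 => /orP[] /eqP; [left|right].
Qed.

(** By [orthogonal_not_signed_perm] it is enough that no row of V U^T has two
    nonzero entries: row i of V selects a single column of U, and that column
    has a single nonzero entry. *)
Lemma signed_perm_mxM_tr (R : realType) (p : nat) (U V : 'M[R]_p) :
  orthogonalmx U -> orthogonalmx V ->
  signed_perm_mx U -> signed_perm_mx V -> signed_perm_mx (V *m U^T).
Proof.
move=> UO VO [_ cU _] [rV _ _]; apply: contrapT => /orthogonal_not_signed_perm.
case=> [|i [k [l [/eqP kl]]]].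
  by apply: orthogonalmxM => //; exact: orthogonalmx_tr.
have [j [_ ju]] := rV i.
have E x : (V *m U^T) i x != 0 -> U x j <> 0.
  rewrite mxE => /eqP nz Uxj; apply: nz; apply: big1 => m _; rewrite mxE.
  have [->|/eqP Vim] := eqVneq (V i m) 0; first by rewrite mul0r.
  by rewrite -(ju _ Vim) Uxj mulr0.
move=> /E Ukj /E Ulj; have [x [_ xu]] := cU j.
by apply: kl; rewrite -(xu _ Ukj) -(xu _ Ulj).
Qed.

(** * Defects as sums over slices, and the separating pair *)

Lemma GTdefect_slices (R : realType) (n p : nat) (Phi : 'M[R[i]]_p)
    (A B : tensor R n p) : Phi \is unitarymx ->
  GTdefect Phi A B = \sum_w
    (\tr (expmx (hatslice Phi A w) *m expmx (hatslice Phi B w))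
      - \tr (expmx (hatslice Phi A w + hatslice Phi B w))).
Proof.
move=> PhiU.
transitivity (\tr (\mxdiag_w (expmx (hatslice Phi A w) *m expmx (hatslice Phi B w)))
    - \tr (\mxdiag_w expmx (hatslice Phi A w + hatslice Phi B w))); last first.
  by rewrite 2!mxtrace_mxdiag sumrB.
rewrite /GTdefect /ttrace; congr (_ - _); congr mxtrace.
- apply: (etrans (lift_tmul _ _ PhiU)); rewrite -mul_mxdiag2.
  by congr (_ *m _); apply: (etrans (lift_texp _ PhiU)); exact: expmx_mxdiag.
- apply: (etrans (lift_texp _ PhiU)); rewrite -expmx_mxdiag; congr expmx.
  by apply: (etrans (lift_tadd _ _ PhiU)); rewrite mxdiagD.
Qed.

(** The tensor whose Phi-transform is X in slice j and zero elsewhere, when Phi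
    is orthogonal. *)
Definition one_slice (R : realType) (n p : nat) (Phi : 'M[R]_p) (j : 'I_p)
    (X : 'M[R[i]]_n) : tensor R n p :=
  [ffun k => (Phi j k)%:C%C *: X].

Lemma hatslice_one_slice (R : realType) (n p : nat) (Phi Psi : 'M[R]_p)
    (j w : 'I_p) (X : 'M[R[i]]_n) :
  hatslice (cplxmx Psi) (one_slice Phi j X) w = ((Psi *m Phi^T) w j)%:C%C *: X.
Proof.
rewrite /hatslice mxE rmorph_sum scaler_suml; apply: eq_bigr => k _.
by rewrite ffunE !mxE scalerA -rmorphM.
Qed.

Lemma thermitian_one_slice (R : realType) (n p : nat) (Phi Psi : 'M[R]_p)
    (j : 'I_p) (X : 'M[R[i]]_n) :
  X \is hermsymmx -> thermitian (cplxmx Psi) (one_slice Phi j X).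
Proof.
move=> /is_hermitianmxP; rewrite expr0 scale1r => XH.
apply/thermitianP => w; rewrite hatslice_one_slice.
apply/is_hermitianmxP; rewrite expr0 scale1r.
apply/matrixP => a b; rewrite !mxE {1}XH !mxE rmorphM /=; congr (_ * _).
by rewrite [RHS]conjc_real.
Qed.

(** The two columns j and k are those that share a row of Phi2 Phi1^T in which
    neither entry vanishes.  Nonnegativity for every Psi is what turns the
    vanishing at Phi1 into optimality. *)
Lemma separating_pair (R : realType) (n p : nat) (Phi1 Phi2 : 'M[R]_p) :
  (1 < n)%N -> orthogonalmx Phi1 -> orthogonalmx Phi2 ->
  ~ signed_perm_mx (Phi2 *m Phi1^T) ->
  exists A B : tensor R n p,
    [/\ forall Psi : 'M[R]_p, thermitian (cplxmx Psi) A,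
        forall Psi : 'M[R]_p, thermitian (cplxmx Psi) B,
        GTdefect (cplxmx Phi1) A B = 0,
        forall Psi, orthogonalmx Psi -> 0 <= GTdefect (cplxmx Psi) A B &
        0 < GTdefect (cplxmx Phi2) A B].
Proof.
move=> n1 O1 O2 nsp.
have [|i [j [k [jk Uij Uik]]]] := orthogonal_not_signed_perm _ nsp.
  by apply: orthogonalmxM => //; exact: orthogonalmx_tr.
have [H [K [Hh Kh [H3 K3 K2 HK] trP]]] := pauli_pair R n1.
pose A := one_slice Phi1 j H; pose B := one_slice Phi1 k K.
pose g (s t : R) := cosh s * cosh t - cosh (Num.sqrt (s ^+ 2 + t ^+ 2)).
have g_ge s t : (s * t) ^+ 2 / 6 <= g s t.
  by apply: coshM_ge; rewrite sqr_sqrtr // addr_ge0 ?sqr_ge0.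
have g0 s t : 0 <= g s t by apply: le_trans (g_ge s t); rewrite divr_ge0 ?sqr_ge0.
have defE Psi : orthogonalmx Psi -> GTdefect (cplxmx Psi) A B =
    2 * (\sum_w g ((Psi *m Phi1^T) w j) ((Psi *m Phi1^T) w k))%:C%C.
  move=> PsiO; rewrite GTdefect_slices; last exact: unitary_cplxmx.
  rewrite rmorph_sum mulr_sumr; apply: eq_bigr => w _.
  rewrite !hatslice_one_slice -trP; apply: GTgap_anticomm => //.
  by rewrite sqr_sqrtr // addr_ge0 ?sqr_ge0.
exists A, B; split.
- by move=> Psi; exact: thermitian_one_slice.
- by move=> Psi; exact: thermitian_one_slice.
(* Phi1 *m Phi1^T = 1, so in each row one of the two arguments of [g] is 0. *)
- rewrite defE // O1 big1 ?mulr0 // => w _; rewrite !mxE /g.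
  have [->|wj] := eqVneq w j.
    rewrite (negPf jk) cosh0 mulr1 expr0n addr0 sqrtr_sqr normr1.
    exact: subrr.
  rewrite cosh0 mul1r expr0n add0r sqrtr_sqr; case: eqP => _.
    by rewrite normr1 subrr.
  by rewrite normr0 subrr.
- move=> Psi PsiO; rewrite defE // mulr_ge0 // lecR; exact: sumr_ge0.
- rewrite defE // mulr_gt0 // ltcR (bigD1 i) //=.
  apply: ltr_wpDr; first exact: sumr_ge0.
  apply: lt_le_trans (g_ge _ _); rewrite divr_gt0 //.
  by rewrite lt0r sqr_ge0 sqrf_eq0 mulf_neq0.
Qed.

Lemma gap_not_optimal (R : realType) (n p : nat) (Phi Psi : 'M[R]_p)
    (A B : tensor R n p) :
  orthogonalmx Psi -> GTdefect (cplxmx Psi) A B = 0 ->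
  0 < GTdefect (cplxmx Phi) A B -> ~ optimal_for Phi A B.
Proof.
by move=> PsiO P0 P1 /(_ _ PsiO); rewrite P0 => /(lt_le_trans P1); rewrite ltxx.
Qed.

Theorem theorem9 (R : realType) (n p : nat) (Phi1 Phi2 : 'M[R]_p)
    (hn : (1 < n)%N) (hp : (0 < p)%N)
    (hPhi1 : orthogonalmx Phi1) (hPhi2 : orthogonalmx Phi2)
    (hdistinct : Phi1 <> Phi2)
    (hU : ~ signed_perm_mx (Phi2 *m Phi1^T)) :
  [/\ (exists A B : tensor R n p,
         [/\ thermitian (cplxmx Phi1) A /\ thermitian (cplxmx Phi2) A,
             thermitian (cplxmx Phi1) B /\ thermitian (cplxmx Phi2) B,
             GTdefect (cplxmx Phi1) A B = 0 &
             0 < GTdefect (cplxmx Phi2) A B]),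
      (exists A' B' : tensor R n p,
         [/\ thermitian (cplxmx Phi1) A' /\ thermitian (cplxmx Phi2) A',
             thermitian (cplxmx Phi1) B' /\ thermitian (cplxmx Phi2) B',
             0 < GTdefect (cplxmx Phi1) A' B' &
             GTdefect (cplxmx Phi2) A' B' = 0]),
      (forall Phi : 'M[R]_p, orthogonalmx Phi -> ~ universally_optimal n Phi) &
      (exists A B A' B' : tensor R n p,
         [/\ [/\ thermitian (cplxmx Phi1) A, thermitian (cplxmx Phi1) B,
                 thermitian (cplxmx Phi1) A' & thermitian (cplxmx Phi1) B'],
             [/\ thermitian (cplxmx Phi2) A, thermitian (cplxmx Phi2) B,
                 thermitian (cplxmx Phi2) A' & thermitian (cplxmx Phi2) B'],
             optimal_for Phi1 A B /\ ~ optimal_for Phi2 A B &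
             optimal_for Phi2 A' B' /\ ~ optimal_for Phi1 A' B'])].
Proof.
have hU' : ~ signed_perm_mx (Phi1 *m Phi2^T).
  by move=> /signed_perm_mx_tr; rewrite trmx_mul trmxK.
have [A [B [hA hB AB1 ABge AB2]]] := separating_pair hn hPhi1 hPhi2 hU.
have [A' [B' [hA' hB' AB2' ABge' AB1']]] := separating_pair hn hPhi2 hPhi1 hU'.
split.
- by exists A, B.
- by exists A', B'.
- move=> Phi PhiO Phi_opt.
  have no_sep Psi : orthogonalmx Psi -> ~ signed_perm_mx (Phi *m Psi^T) -> False.
    move=> PsiO nsp.
    have [X [Y [hX hY XY0 _ XYgt]]] := separating_pair hn PsiO PhiO nsp.
    exact: gap_not_optimal PsiO XY0 XYgt (Phi_opt _ _ (hX _) (hY _)).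
  have sp Psi : orthogonalmx Psi -> signed_perm_mx (Psi *m Phi^T).
    move=> PsiO; rewrite -[Psi *m _]trmxK; apply: signed_perm_mx_tr.
    by rewrite trmx_mul trmxK; apply: contrapT => /(no_sep _ PsiO).
  apply: hU; have -> : Phi2 *m Phi1^T = (Phi2 *m Phi^T) *m (Phi1 *m Phi^T)^T.
    by rewrite trmx_mul trmxK mulmxA -(mulmxA Phi2) (mulmx1C PhiO) mulmx1.
  have PhiTO := orthogonalmx_tr PhiO.
  apply: signed_perm_mxM_tr; [exact: orthogonalmxM|exact: orthogonalmxM| |].
    exact: sp.
  exact: sp.
- exists A, B, A', B'; split.
  + by split; [exact: hA|exact: hB|exact: hA'|exact: hB'].
  + by split; [exact: hA|exact: hB|exact: hA'|exact: hB'].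
  + split; last exact: gap_not_optimal hPhi1 AB1 AB2.
    by move=> Psi PsiO; rewrite AB1; exact: ABge.
  + split; last exact: gap_not_optimal hPhi2 AB2' AB1'.
    by move=> Psi PsiO; rewrite AB2'; exact: ABge'.
Qed.
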